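(* Let $m,n\ge 1$ and $t>2$ be integers, and let $G_{m,n}$ be the $m\times n$ grid graph. Then \[\gamma_{t,2}(G_{m,n}) \le \left\lfloor \frac{(m+2(t-2))(n+2(t-2))}{2(t-1)^2}\right\rfloor .\]
   Context: The $m\times n$ grid graph $G_{m,n}$ has vertex set $\{(i,j)\in\mathbb{Z}^2: 0\le i<m,\ 0\le j<n\}$, with two vertices adjacent iff they differ by 1 in exactly one coordinate. For a graph $G=(V,E)$ and positive integers $t,r$, a tower vertex $T\in V$ supplies to a vertex $v\in V$ the signal $sig(T,v)=\max(t-dist(T,v),0)$, where $dist$ is the graph (shortest-path) distance. A $(t,r)$ broadcast on $G$ is a set $\mathbb{T}\subseteq V$ such that for every $v\in V$, $\sum_{T\in\mathbb{T}} sig(T,v)\ge r$. The $(t,r)$ broadcast domination number $\gamma_{t,r}(G)$ is the minimum cardinality of a $(t,r)$ broadcast on $G$. *)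

(* Defs.v *)
From mathcomp Require Import all_boot.

Set Implicit Arguments.
Unset Strict Implicit.
Unset Printing Implicit Defensive.

(* A finite simple graph is given by its adjacency relation [e], which is
   meant to be symmetric and irreflexive. *)
Section Broadcast.
Variables (T : finType) (e : rel T).

Definition has_walk (x y : T) (k : nat) : bool :=
  [exists p : k.-tuple T, path e x p && (last x p == y)].

(* A shortest path in a graph on #|T| vertices has fewer than #|T| edges, so
   it suffices to search below #|T|. The value is the junk #|T| when x and y
   are not connected; [signal] treats that case separately. *)
Definition dist (x y : T) : nat := find (has_walk x y) (iota 0 #|T|).

(* max(t - dist, 0) is truncated subtraction; unconnected vertices are at
   infinite distance and receive nothing. *)
Definition signal (t : nat) (x y : T) : nat :=
  if connect e x y then t - dist x y else 0.

Definition broadcast (t r : nat) (B : {set T}) : bool :=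
  [forall v, r <= \sum_(x in B) signal t x v].

(* A superset of a broadcast is a broadcast, so some broadcast exists iff the
   default candidate [set: T] is one (see [broadcast_setT] for r <= t). When
   there is none the value is the junk #|T|. *)
Definition gamma (t r : nat) : nat :=
  #|[arg min_(B < [set: T] | broadcast t r B) #|B|]|.

Lemma dist0 (x : T) : dist x x = 0.
Proof.
have : 0 < #|T| by apply/card_gt0P; exists x.
rewrite /dist; case: #|T| => //= k _.
suff -> : has_walk x x 0 by [].
by apply/existsP; exists [tuple]; rewrite /= eqxx.
Qed.

Lemma broadcast_setT (t r : nat) : r <= t -> broadcast t r [set: T].
Proof.
move=> le_rt; apply/forallP => v; rewrite (bigD1 v) ?inE //=.
by rewrite /signal connect0 dist0 subn0 (leq_trans le_rt) ?leq_addr.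
Qed.

Lemma gammaP (t r : nat) : r <= t ->
  (exists2 B, broadcast t r B & #|B| = gamma t r) /\
  (forall B, broadcast t r B -> gamma t r <= #|B|).
Proof.
move=> le_rt; rewrite /gamma.
case: arg_minnP => [|B bB minB]; first exact: broadcast_setT.
by split=> //; exists B.
Qed.

End Broadcast.

Definition differ_by_one (a b : nat) : bool := (a == b.+1) || (b == a.+1).

Definition grid (m n : nat) : rel ('I_m * 'I_n) := fun u v =>
  (differ_by_one u.1 v.1 && (u.2 == v.2)) ||
  ((u.1 == v.1) && differ_by_one u.2 v.2).
Arguments grid : clear implicits.

(* Main.v *)
(* Put s = t - 1. In the plane, the lattice spanned by (s, s) and (2s, 0) has
   index 2s^2, and the l1-balls of radius s around its points tile: every point
   is at distance < s from a lattice point (signal >= 2) or at distance s from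
   two of them (signal 1 + 1). Only lattice points within s - 1 of the grid in
   each coordinate are kept; when min(m, n) >= 2 the points lost this way are
   never needed. Some translate has at most the average number of points in
   the enlarged rectangle. Finally, clamping each point to the grid only
   shortens distances, and strictly so for a point that moves, so two towers
   that get merged leave one of signal >= 2. Paths are treated by hand, with
   towers 2s apart. *)
Require Import Defs.
From mathcomp Require Import all_boot.
From mathcomp Require Import zify.

Set Implicit Arguments.
Unset Strict Implicit.
Unset Printing Implicit Defensive.

(** * Walks in the grid and lower bounds on signals *)

Section Signal.
Variables (T : finType) (e : rel T).

Lemma signal_ge_walk (t k : nat) (x y : T) :
  has_walk e x y k -> t - k <= signal e t x y.
Proof.
move=> w; have/existsP[p /andP[ep /eqP lp]] := w.
have -> : signal e t x y = t - dist e x y.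
  by rewrite /signal (_ : connect e x y) //; apply/connectP; exists p.
apply: leq_sub2l; rewrite /dist.
(* [find] never exceeds the length [#|T|] of the search range, so a walk at least that long bounds
   [dist] trivially. *)
have [ltk|lek] := ltnP k #|T|; last first.
  by apply: leq_trans lek; rewrite -[leqRHS](size_iota 0) find_size.
rewrite leqNgt; apply/negP => /(before_find 0).
by rewrite nth_iota // add0n w.
Qed.

Lemma has_walkS (x z y : T) (k : nat) :
  e x z -> has_walk e z y k -> has_walk e x y k.+1.
Proof.
move=> exz /existsP[p pP]; apply/existsP; exists [tuple of z :: p].
by rewrite /= exz.
Qed.

End Signal.

Definition l1 (p q : nat * nat) : nat :=
  (p.1 - q.1) + (q.1 - p.1) + ((p.2 - q.2) + (q.2 - p.2)).

Definition grid_pt (m n : nat) (u : 'I_m * 'I_n) : nat * nat :=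
  (val u.1, val u.2).

(** Correct the first coordinate one unit at a time, then the second; each step lowers [l1] by
    one. *)
Lemma grid_walk (m n : nat) (u v : 'I_m * 'I_n) :
  has_walk (grid m n) u v (l1 (grid_pt u) (grid_pt v)).
Proof.
case: v => c d; move Ek: (l1 _ _) => k.
elim: k u Ek => [|k IHk] [a b].
  rewrite /l1 /= => E; apply/existsP; exists [tuple] => /=.
  by apply/eqP; congr pair; apply: val_inj => /=; lia.
rewrite /l1 /= => E.
have step (a' : 'I_m) (b' : 'I_n) : grid m n (a, b) (a', b') ->
    l1 (grid_pt (a', b')) (grid_pt (c, d)) = k ->
    has_walk (grid m n) (a, b) (c, d) k.+1.
  by move=> g /IHk; apply: has_walkS.
have [ltac|ltca|eac] := ltngtP a c.
- have am : a.+1 < m by apply: leq_ltn_trans (ltn_ord c).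
  apply: (step (Ordinal am) b); last by rewrite /l1 /=; lia.
  by rewrite /grid /differ_by_one /= !eqxx orbT.
- have am : a.-1 < m by apply: leq_ltn_trans (ltn_ord a); lia.
  apply: (step (Ordinal am) b); last by rewrite /l1 /=; lia.
  by rewrite /grid /differ_by_one /= prednK ?eqxx //; lia.
have [ltbd|ltdb|ebd] := ltngtP b d; last by lia.
- have bn : b.+1 < n by apply: leq_ltn_trans (ltn_ord d).
  apply: (step a (Ordinal bn)); last by rewrite /l1 /=; lia.
  by rewrite /grid /differ_by_one /= !eqxx !orbT.
have bn : b.-1 < n by apply: leq_ltn_trans (ltn_ord b); lia.
apply: (step a (Ordinal bn)); last by rewrite /l1 /=; lia.
by rewrite /grid /differ_by_one /= prednK ?eqxx ?orbT //; lia.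
Qed.

(* Candidate towers may lie outside the grid; the grid is placed at offset
   (2s, 2s) so that all their coordinates are naturals. *)
Definition shift_pt (s i j : nat) : nat * nat := (i + 2 * s, j + 2 * s).

(** This is signal 2 for t = s + 1. The clause [p <> q] reflects that a broadcast is a set, so a
    tower counts once. *)
Definition covers (s : nat) (ps : seq (nat * nat)) (v : nat * nat) : Prop :=
  (exists2 p, p \in ps & l1 p v < s) \/
  (exists p q, [/\ p \in ps, q \in ps, p <> q, l1 p v <= s & l1 q v <= s]).

Lemma gamma_le_cover (m n s : nat) (ps : seq (nat * nat)) :
  0 < m -> 0 < n -> 0 < s ->
  (forall i j, i < m -> j < n -> covers s ps (shift_pt s i j)) ->
  gamma (grid m n) s.+1 2 <= size ps.
Proof.
case: m => // m; case: n => // n _ _ s_gt0 cov.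
pose cl (p : nat * nat) : 'I_m.+1 * 'I_n.+1 :=
  (inord (minn (p.1 - 2 * s) m), inord (minn (p.2 - 2 * s) n)).
pose B := [set u in [seq cl p | p <- ps]].
have cl_le p (v : 'I_m.+1 * 'I_n.+1) : l1 (grid_pt (cl p)) (grid_pt v) <=
    l1 p (shift_pt s v.1 v.2) ?= iff
    (p == shift_pt s (cl p).1 (cl p).2).
  case: p v => [x y] [i j].
  have im : i < m.+1 := ltn_ord i; have jn : j < n.+1 := ltn_ord j.
  rewrite /cl /l1 /shift_pt /grid_pt /= !inordK ?ltnS ?geq_minr // xpair_eqE.
  by split; lia.
have clB p : p \in ps -> cl p \in B by move=> pps; rewrite inE map_f.
have sig p (v : 'I_m.+1 * 'I_n.+1) k : l1 (grid_pt (cl p)) (grid_pt v) <= k ->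
    s.+1 - k <= signal (grid m.+1 n.+1) s.+1 (cl p) v.
  by move=> le_k; apply: leq_trans (signal_ge_walk _ (grid_walk _ _)); lia.
have one p (v : 'I_m.+1 * 'I_n.+1) : p \in ps ->
    l1 (grid_pt (cl p)) (grid_pt v) < s ->
    2 <= \sum_(x in B) signal (grid m.+1 n.+1) s.+1 x v.
  move=> pps lt_s; rewrite (bigD1 (cl p)) ?clB //=.
  by apply: leq_trans (leq_addr _ _); have := sig p v s.-1; lia.
have bB : broadcast (grid m.+1 n.+1) s.+1 2 B.
  apply/forallP => v.
  case: (cov v.1 v.2 (ltn_ord _) (ltn_ord _)) => [[p pps lt_s]|].
    by apply: (one p) => //; apply: leq_ltn_trans lt_s; apply: (cl_le p v).1.
  case=> p [q [pps qps npq lep leq]].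
  have moved x : x \in ps -> l1 x (shift_pt s v.1 v.2) <= s ->
      x != shift_pt s (cl x).1 (cl x).2 ->
      2 <= \sum_(x in B) signal (grid m.+1 n.+1) s.+1 x v.
    move=> xps lex nx; apply: (one x) => //; apply: leq_trans lex.
    by rewrite (ltn_leqif (cl_le x v)).
  (* Distinct points with the same clamped image cannot both be in the grid already, so one of them
     moved and came strictly nearer. *)
  have [Ecl|ncl] := eqVneq (cl p) (cl q).
    have [pE|] := eqVneq p (shift_pt s (cl p).1 (cl p).2); last exact: moved.
    have [qE|] := eqVneq q (shift_pt s (cl q).1 (cl q).2); last exact: moved.
    by case: npq; rewrite pE qE Ecl.
  rewrite (bigD1 (cl p)) ?clB //= (bigD1 (cl q)) ?clB 1?eq_sym //=.
  have := sig p v s (leq_trans (cl_le p v).1 lep).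
  by have := sig q v s (leq_trans (cl_le q v).1 leq); lia.
apply: leq_trans ((gammaP _ _).2 B bB) _; first by [].
by rewrite cardsE -(size_map cl ps) card_size.
Qed.

(** * Covers by lattice cosets, and averaging over the cosets *)

Lemma pigeonhole_le (T : Type) (C : finType) (f : T -> C) (c0 : C) (l : seq T) :
  exists c, count (fun x => f x == c) l * #|C| <= size l.
Proof.
have sumE : \sum_c count (fun x => f x == c) l = size l.
  elim: l => [|x l IHl] /=; first by rewrite big1.
  rewrite big_split /= IHl (bigD1 (f x)) //= eqxx big1 ?addn0 // => c.
  by rewrite eq_sym => /negPf->.
case: (arg_minnP (fun c => count (fun x => f x == c) l) (erefl : predT c0)).
move=> c _ minc; exists c; rewrite -sumE mulnC -sum_nat_const.
by apply: leq_sum => d _; apply: minc.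
Qed.

Section Lattice.
Variables (s : nat) (s_gt0 : 0 < s).

(** Canonical form modulo the lattice: remove [p.2 %/ s] copies of (s, s), then reduce modulo (2s,
    0). Adding s instead of subtracting it is the same modulo 2s and avoids truncation. *)
Definition coset (p : nat * nat) : nat * nat :=
  ((p.1 + s * (p.2 %/ s)) %% (2 * s), p.2 %% s).

Lemma coset_diag (x y : nat) : coset (x + s, y + s) = coset (x, y).
Proof.
rewrite /coset /= modnDr divnDr // divnn s_gt0.
by rewrite (_ : _ + _ = x + s * (y %/ s) + 2 * s) ?modnDr //; lia.
Qed.

Lemma coset_horiz (x y : nat) : coset (x + 2 * s, y) = coset (x, y).
Proof. by rewrite /coset /= addnAC modnDr. Qed.

(** A 2s by s box is a fundamental domain. Choosing [r] first settles the second coordinate and the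
    quotient by [s]; then [a] adjusts the first. *)
Lemma coset_below (X Y p q : nat) : p < 2 * s -> q < s -> 2 * s <= X ->
  2 * s <= Y ->
  exists a r, [/\ a < 2 * s, r < s & coset (X - a, Y - r) = (p, q)].
Proof.
move=> lt_p lt_q leX leY.
have Er := divn_eq (Y - q) s; have lt_r := ltn_pmod (Y - q) s_gt0.
set r := (Y - q) %% s in Er lt_r.
have s2_gt0 : 0 < 2 * s by lia.
pose Z := X + s * ((Y - r) %/ s).
have Ea := divn_eq (Z - p) (2 * s); have lt_a := ltn_pmod (Z - p) s2_gt0.
set a := (Z - p) %% (2 * s) in Ea lt_a.
exists a, r; split=> //; rewrite /coset /=; congr pair.
  rewrite (_ : X - a + _ = (Z - p) %/ (2 * s) * (2 * s) + p).
    by rewrite modnMDl modn_small.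
  by rewrite -/Z; lia.
by rewrite (_ : Y - r = (Y - q) %/ s * s + q) ?modnMDl ?modn_small; lia.
Qed.

Lemma lattice_cover (m n i j : nat) (c : nat * nat) (ps : seq (nat * nat)) :
  1 < m -> 1 < n -> i < m -> j < n -> c.1 < 2 * s -> c.2 < s ->
  (forall x y, s < x < s.+1 + (m + 2 * (s - 1)) ->
     s < y < s.+1 + (n + 2 * (s - 1)) -> coset (x, y) = c -> (x, y) \in ps) ->
  covers s ps (shift_pt s i j).
Proof.
case: c => p q /= m_gt1 n_gt1 lt_im lt_jn lt_p lt_q psP; rewrite /shift_pt.
have [a [r [lt_a lt_r E1]]] :=
  coset_below lt_p lt_q (leq_addl i (2 * s)) (leq_addl j (2 * s)).
move EX : (i + 2 * s) E1 => X; move EY : (j + 2 * s) => Y E1.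
have E2 : coset (X - a + 2 * s, Y - r) = (p, q) by rewrite coset_horiz.
have E3 : coset (X - a + s, Y - r + s) = (p, q) by rewrite coset_diag.
(* With P = (X - a, Y - r), the tests ask whether P, P + (2s, 0) or P + (s, s) is nearer than s; the
   distances are a + r, 2s - a + r and |s - a| + s - r. *)
have [lt1|ge1] := ltnP (a + r) s.
  by left; exists (X - a, Y - r); [apply: psP E1|rewrite /l1 /=]; lia.
have [lt2|ge2] := ltnP (s + r) a.
  by left; exists (X - a + 2 * s, Y - r); [apply: psP E2|rewrite /l1 /=]; lia.
have [lt3|ge3] := ltnP ((s - a) + (a - s)) r.
  by left; exists (X - a + s, Y - r + s); [apply: psP E3|rewrite /l1 /=]; lia.
right; have [r0|r_gt0] := posnP r.
  (* The point is a corner common to four balls. *)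
  have Ea : a = s by lia.
  subst a r; rewrite subn0 in E1 E2 E3.
  have E4 : coset (X, Y - s) = (p, q).
    rewrite -E2 (_ : X - s + 2 * s = X + s); last by lia.
    by rewrite -(coset_diag X (Y - s)) subnK //; lia.
  (* X - s is in the enlarged rectangle iff i > 0; for i = 0, X + s = 3s is inside because m > 1. *)
  have hx : exists2 x, (x, Y) \in ps & (x = X - s) \/ (x = X + s).
    have [i0|i_gt0] := posnP i; last first.
      by exists (X - s); [apply: psP E1; lia|left].
    exists (X + s); last by right.
    by apply: psP; try lia; rewrite -E2; congr coset; congr pair; lia.
  have hy : exists2 y, (X, y) \in ps & (y = Y - s) \/ (y = Y + s).
    have [j0|j_gt0] := posnP j; last first.
      by exists (Y - s); [apply: psP E4; lia|left].
    exists (Y + s); last by right.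
    by apply: psP; try lia; rewrite -E3; congr coset; congr pair; lia.
  have [x xps hx'] := hx; have [y yps hy'] := hy.
  exists (x, Y), (X, y); split=> //; rewrite /l1 /=; try lia.
  by case=> *; lia.
(* The failed tests force r = |s - a|, so two centres are at distance exactly s; 0 < r < s keeps
   their coordinate offsets below s. *)
have [le_as|lt_sa] := leqP a s.
  exists (X - a, Y - r), (X - a + s, Y - r + s); split; rewrite /l1 /=; try lia.
  - by apply: psP E1; lia.
  - by apply: psP E3; lia.
  - by case=> *; lia.
exists (X - a + 2 * s, Y - r), (X - a + s, Y - r + s).
split; rewrite /l1 /=; try lia.
- by apply: psP E2; lia.
- by apply: psP E3; lia.
- by case=> *; lia.
Qed.

Lemma exists_grid_cover (m n : nat) : 1 < m -> 1 < n ->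
  exists2 ps, forall i j, i < m -> j < n -> covers s ps (shift_pt s i j) &
    size ps <= ((m + 2 * (s - 1)) * (n + 2 * (s - 1))) %/ (2 * s ^ 2).
Proof.
move=> m_gt1 n_gt1; set M := m + _; set N := n + _.
have s2_gt0 : 0 < 2 * s by lia.
pose f (p : nat * nat) : 'I_(2 * s) * 'I_s :=
  (Ordinal (ltn_pmod (p.1 + s * (p.2 %/ s)) s2_gt0),
   Ordinal (ltn_pmod p.2 s_gt0)).
pose l := [seq (x, y) | x <- iota s.+1 M, y <- iota s.+1 N].
have [c cP] := pigeonhole_le f (Ordinal s2_gt0, Ordinal s_gt0) l.
exists [seq p <- l | f p == c].
  move=> i j lt_i lt_j.
  apply: (@lattice_cover m n i j (val c.1, val c.2)); rewrite /= ?ltn_ord //.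
  move=> x y hx hy [E1 E2]; rewrite mem_filter; apply/andP; split.
    by rewrite [c]surjective_pairing /f; apply/eqP; congr pair; apply: val_inj.
  by apply: allpairs_f; rewrite mem_iota.
rewrite size_filter leq_divRL ?muln_gt0 ?expn_gt0 ?s_gt0 //.
move: cP; rewrite card_prod !card_ord size_allpairs !size_iota.
by rewrite -mulnA -mulnn.
Qed.

(** Tower k, at 2sk + s - 1, suffices for positions 2sk to 2sk + 2s - 2 and shares the next one with
    tower k + 1. [K] counts the k with 2sk at most m; the last tower may lie beyond the path. *)
Lemma exists_path_cover (m : nat) : 1 < s -> 0 < m ->
  exists2 ps, forall i, i < m -> covers s ps (shift_pt s i 0) &
    size ps <= ((m + 2 * (s - 1)) * (1 + 2 * (s - 1))) %/ (2 * s ^ 2).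
Proof.
move=> s_gt1 m_gt0; pose K := (m + 2 * s) %/ (2 * s).
have s2_gt0 : 0 < 2 * s by lia.
pose tower k := shift_pt s (k * (2 * s) + s.-1) 0.
exists [seq tower k | k <- iota 0 K].
  move=> i lt_i; have Ei := divn_eq i (2 * s).
  have lt_a := ltn_pmod i s2_gt0.
  set k := i %/ (2 * s) in Ei; set a := i %% (2 * s) in Ei lt_a.
  have towerP h : h * (2 * s) <= m -> tower h \in [seq tower k | k <- iota 0 K].
    move=> le_h; apply: map_f; rewrite mem_iota /= add0n /K leq_divRL //; lia.
  have [lt1|ge1] := ltnP a (2 * s).-1.
    left; exists (tower k); first by apply: towerP; lia.
    by rewrite /l1 /=; lia.
  right; exists (tower k), (tower k.+1); split.
  - by apply: towerP; lia.
  - by apply: towerP; lia.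
  - by case=> E; lia.
  - by rewrite /l1 /=; lia.
  - by rewrite /l1 /=; lia.
rewrite size_map size_iota leq_divRL ?muln_gt0 ?expn_gt0 ?s_gt0 //.
have leK : K * (2 * s) <= m + 2 * s by apply: leq_divM.
(* For K = 1 the bound follows from (2s - 1)^2 >= 2s^2, true for s > 1; for K >= 2, [leK] gives m >=
   2s. *)
rewrite -mulnn; have [K1|K2] := leqP K 1; nia.
Qed.

End Lattice.

Lemma covers_swap (s i j : nat) (ps : seq (nat * nat)) :
  covers s ps (shift_pt s i j) ->
  covers s [seq (p.2, p.1) | p <- ps] (shift_pt s j i).
Proof.
have mem p : p \in ps -> (p.2, p.1) \in [seq (q.2, q.1) | q <- ps].
  exact: (map_f (fun q => (q.2, q.1))).
have l1C p : l1 (p.2, p.1) (shift_pt s j i) = l1 p (shift_pt s i j).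
  by rewrite /l1 addnC.
case=> [[p pps lt_s]|[p [q [pps qps npq lep leq]]]].
  by left; exists (p.2, p.1); rewrite ?l1C ?mem.
right; exists (p.2, p.1), (q.2, q.1); rewrite !l1C !mem //; split=> // -[E2 E1].
by apply: npq; rewrite [p]surjective_pairing [q]surjective_pairing E1 E2.
Qed.

Theorem theorem1 (m n t : nat) (hm : 1 <= m) (hn : 1 <= n) (ht : 2 < t) :
  gamma (grid m n) t 2 <=
    ((m + 2 * (t - 2)) * (n + 2 * (t - 2))) %/ (2 * (t - 1) ^ 2).
Proof.
case: t ht => // s s_gt1.
have s_gt0 : 0 < s by lia.
rewrite subn1 -[s.+1 - 2]/(s - 1) /=.
suff [ps cov le_ps] : exists2 ps,
    forall i j, i < m -> j < n -> covers s ps (shift_pt s i j) &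
    size ps <= ((m + 2 * (s - 1)) * (n + 2 * (s - 1))) %/ (2 * s ^ 2).
  exact: leq_trans (gamma_le_cover hm hn s_gt0 cov) le_ps.
have [n_gt1|n_le1] := ltnP 1 n; last first.
  have -> : n = 1 by lia.
  have [ps cov le_ps] := exists_path_cover s_gt0 s_gt1 hm.
  by exists ps => // i [|//] lt_i _; apply: cov.
have [m_gt1|m_le1] := ltnP 1 m; first exact: exists_grid_cover.
have -> : m = 1 by lia.
have [ps cov le_ps] := exists_path_cover s_gt0 s_gt1 hn.
(* Exchanging coordinates turns this path into the previous case. *)
exists [seq (p.2, p.1) | p <- ps]; last by rewrite size_map mulnC.
by move=> [|//] j _ lt_j; apply: covers_swap; apply: cov.
Qed.
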